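(* Let $K$ be a real algebraic number field (a subfield of $\mathbb{R}$ of finite degree over $\mathbb{Q}$). Let $\wp_K$ be the set of Pisot numbers $\theta\in K$ with $\mathbb{Q}(\theta)=K$, listed increasingly as $\theta_1<\theta_2<\theta_3<\cdots$. Let $$D_K:=\{\theta_n-\theta_m \mid (m,n)\in\mathbb{N}^2,\ n>m\}=\{\alpha-\alpha' \mid \alpha,\alpha'\in\wp_K,\ \alpha>\alpha'\},\qquad \mathcal{F}_K:=\{\theta_{n+1}-\theta_n\mid n\in\mathbb{N}\}.$$ Then: (i) $1\in D_K$; (ii) $\wp_K\subsetneq D_K$; (iii) if $K\neq\mathbb{Q}$, then the set $D_K\setminus\wp_K$ is infinite, and $\mathcal{F}_K$ has at least two elements.
   Context: A Pisot number is a real algebraic integer greater than $1$ all of whose other conjugates (over $\mathbb{Q}$) have modulus less than $1$. The set $\wp_K$ is infinite and discrete in $[1,\infty)$, so it can be enumerated increasingly. Note $\wp_K-\wp_K=(-D_K)\cup\{0\}\cup D_K$. *)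

(* Defs.v *)
(* real algebraic numbers are the real elements of algC. *)
From HB Require Import structures.
From mathcomp Require Import all_boot all_order all_algebra all_field.
Set Implicit Arguments. Unset Strict Implicit. Unset Printing Implicit Defensive.
Import Order.TTheory GRing.Theory Num.Theory.
Local Open Scope ring_scope.

Definition is_subfield (K : algC -> Prop) : Prop :=
  [/\ K 0, K 1, (forall x y, K x -> K y -> K (x - y)),
      (forall x y, K x -> K y -> K (x * y)) &
      (forall x, K x -> x != 0 -> K x^-1)].

(* K is a real algebraic number field: a subfield of R of finite degree over Q.
   (Its elements are algebraic, hence K lives inside the real part of algC.) *)
Definition real_number_field (K : algC -> Prop) : Prop :=
  [/\ is_subfield K,
      (forall x, K x -> x \is Num.real) &
      exists s : seq algC, (forall x, x \in s -> K x) /\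
        forall x, K x -> exists c : seq rat,
          x = \sum_(i < size s) ratr c`_i * s`_i].

Definition gen_field (theta : algC) : algC -> Prop :=
  fun x => forall F : algC -> Prop, is_subfield F -> F theta -> F x.

Definition pisot (theta : algC) : Prop :=
  [/\ theta \is Num.real, 1 < theta, theta \in Aint &
      forall z, root (minCpoly theta) z -> z != theta -> `|z| < 1].

Definition wp (K : algC -> Prop) : algC -> Prop :=
  fun theta => [/\ K theta, pisot theta & forall x, gen_field theta x <-> K x].

Definition DK (K : algC -> Prop) : algC -> Prop :=
  fun d => exists a a', [/\ wp K a, wp K a', a' < a & d = a - a'].

Definition FK (K : algC -> Prop) : algC -> Prop :=
  fun d => exists a a', [/\ wp K a, wp K a', a' < a, d = a - a' &
                         forall b, wp K b -> ~ (a' < b /\ b < a)].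

Definition infinite_set (P : algC -> Prop) : Prop :=
  ~ exists s : seq algC, forall x, P x -> x \in s.

(* Main.v *)
(* Write K = Q(g) with g an algebraic integer, and call an automorphism u of the
   algebraic numbers nontrivial when u g <> g. An algebraic integer x > 1 of K is
   in wp K iff |u x| < 1 for every nontrivial u. Approximating simultaneously the
   coefficients of the real polynomial minCpoly g / (X - g) by rationals yields
   integers y <> 0 of K with all |u y| small; rounding the coordinates of x / y
   then shows that the values u x of any x in K can be approximated by those of
   integers a of K with a as large as we like. Taking a close to - y / 2 makes a
   and a + y both Pisot as soon as the |u y| are bounded by some c < 2: this puts
   1, wp K, and infinitely many y close to 3 / 2, into DK K. Since norms of nonzero
   integers are at least 1, wp K is discrete, so successors exist; were all the
   gaps equal to some t, then |u (a + n t)| < 1 for all n would force t = 0. *)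
Require Import Defs.
From Stdlib Require Import Classical_Prop.
From HB Require Import structures.
From mathcomp Require Import all_boot all_order all_algebra all_field.
Import Order.TTheory GRing.Theory Num.Theory.
Local Open Scope ring_scope.

(** * Conjugates, minimal polynomials and automorphisms of the algebraic numbers *)

Local Notation pQtoC := (map_poly (ratr : rat -> algC)).

Lemma aut_horner_ratr (u : {rmorphism algC -> algC}) (f : {poly rat}) x :
  u (pQtoC f).[x] = (pQtoC f).[u x].
Proof.
rewrite -horner_map -map_poly_comp; congr _.[_].
by apply: eq_map_poly => a /=; rewrite fmorph_rat.
Qed.

Lemma root_minCpoly_aut (u : {rmorphism algC -> algC}) x :
  root (minCpoly x) (u x).
Proof. by rewrite -(minCpoly_aut u) root_minCpoly. Qed.

(** The map sending [x] to [z] is defined on Q([x]), extends to the splitting field [Qr] of the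
    minimal polynomial because that field is normal, and from there to all of [algC]. *)
Lemma exists_aut_of_root x z :
  root (minCpoly x) z -> {u : {rmorphism algC -> algC} | u x = z}.
Proof.
move=> xz; have [p [Dp mon_p] dv_p] := minCpolyP x.
have [r Dr] := closed_field_poly_normal (pQtoC p : {poly algC}).
rewrite lead_coef_map (monicP mon_p) rmorph1 scale1r in Dr.
have rx : x \in r by rewrite -root_prod_XsubC -Dr -Dp root_minCpoly.
have rz : z \in r by rewrite -root_prod_XsubC -Dr -Dp.
have [Qr [QrC [rr Drr genQr]]] := num_field_exists r.
have [xx Dx] : {xx | QrC xx = x}.
  by move: rx; rewrite -Drr => /mapP/sig2_eqW[xx]; exists xx.
have [zz Dz] : {zz | QrC zz = z}.
  by move: rz; rewrite -Drr => /mapP/sig2_eqW[zz]; exists zz.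
have pr_map q : map_poly QrC (map_poly (in_alg Qr) q) = pQtoC q.
  rewrite -map_poly_comp; apply: eq_map_poly => a.
  by rewrite /= rmorphZ_num rmorph1 mulr1.
have hom1 : kHom 1 1 (\1%VF : 'End(Qr)) by rewrite kHom1.
(* The minimal polynomial of [xx] over the prime field has rational coefficients and kills [x], so
   it is a multiple of [p] and also vanishes at [z]. *)
have root_zz : root (map_poly \1%VF (minPoly 1 xx)) zz.
  rewrite -(fmorph_root QrC) Dz -map_poly_comp.
  rewrite (@eq_map_poly _ _ _ QrC) => [|a]; last by rewrite /= id_lfunE.
  set p1 := map_poly _ _.
  have [q1 Dp1] : exists q1, p1 = pQtoC q1.
    have aP i : (minPoly 1 xx)`_i \in 1%VS.
      by apply/polyOverP; apply: minPolyOver.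
    have{aP} a_ i := sig_eqW (vlineP _ _ (aP i)).
    exists (\poly_(i < size (minPoly 1 xx)) sval (a_ i)).
    apply/polyP=> i; rewrite coef_poly coef_map coef_poly /=.
    case: ifP => _; rewrite ?rmorph0 //; case: (a_ i) => a /= ->.
    by rewrite alg_num_field fmorph_rat.
  have: root p1 x by rewrite -Dx fmorph_root root_minPoly.
  rewrite Dp1 dv_p => /dvdpP[r1 ->].
  by rewrite rmorphM rootM /= -Dp xz orbT.
have homx := kHomExtendP (subvv _) hom1 root_zz.
pose pr := map_poly (in_alg Qr) p.
have Qpr : pr \is a polyOver 1%VS.
  by apply/polyOverP=> i; rewrite coef_map memvZ ?memv_line.
have split1 : splittingFieldFor 1 pr {:Qr}.
  exists rr => //; congr (_ %= _): (eqpxx pr); apply/(map_poly_inj QrC).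
  rewrite pr_map Dr -Drr big_map rmorph_prod /=.
  by apply: eq_bigr => y _; rewrite map_polyXsubC.
have splitQr : splittingFieldFor <<1; xx>>%AS pr {:Qr}.
  exact: splittingFieldForS (sub1v _) (subvf _) split1.
have [f1 hom_f1 Df1] := kHom_extends (sub1v _) homx Qpr splitQr.
pose f1mM := GRing.isMonoidMorphism.Build _ _ f1 (kHom_monoid_morphism hom_f1).
pose phi : {rmorphism Qr -> Qr} := HB.pack (fun_of_lfun f1) f1mM.
have [u Du] := extend_algC_subfield_aut QrC phi.
exists u; rewrite -Dx -Du /= -Df1 ?memv_adjoin //.
by rewrite (kHomExtend_val hom1 root_zz) Dz.
Qed.

(** Separability in characteristic 0: an irreducible [p] is coprime to its nonzero derivative. *)
Lemma minCpoly_roots x :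
  {r : seq algC | minCpoly x = \prod_(z <- r) ('X - z%:P) & uniq r}.
Proof.
have [p [Dp mon_p] dv_p] := minCpolyP x.
have [r Dr] := closed_field_poly_normal (minCpoly x).
rewrite (monicP (minCpoly_monic x)) scale1r in Dr; exists r => //.
have nz_p := monic_neq0 mon_p.
have sz_p : (1 < size p)%N
  by rewrite -(size_map_poly (ratr : {rmorphism rat -> algC})) -Dp size_minCpoly.
have irr_p : irreducible_poly p.
  have px : root (pQtoC p) x by rewrite dv_p.
  apply/(subfx_irreducibleP px nz_p) => q qx nz_q.
  by rewrite dvdp_leq // -dv_p.
rewrite -separable_prod_XsubC -Dr Dp separable_map unlock.
rewrite irreducible_poly_coprime //; apply/negP => /dvdp_leq dvd_p.
(* The top coefficient of the derivative is the degree of [p], since [p] is monic. *)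
have nz_dp : p^`() != 0.
  apply/eqP => /(congr1 (fun q : {poly rat} => q`_(size p).-2)).
  have -> : (size p) = (size p).-2.+2 by case: (size p) sz_p => [|[]].
  rewrite /= coef_deriv coef0 => /eqP; rewrite mulrn_eq0 /=.
  have -> : (size p).-2.+1 = (size p).-1 by case: (size p) sz_p => [|[]].
  by rewrite -lead_coefE (monicP mon_p) oner_eq0.
by have := leq_trans (lt_size_deriv nz_p) (dvd_p nz_dp); rewrite ltnn.
Qed.

(** If [b] clears the denominators of the minimal polynomial [c], of degree [n], then
    [b ^+ n * c(X / b)] is monic with integer coefficients and kills [b * z]. *)
Lemma exists_Aint_multiple z :
  exists2 a : algC, a \in Num.int /\ a != 0 & a * z \in Aint.
Proof.
have [p [Dp mon_p] _] := minCpolyP z.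
have [q [a nz_a Dq]] := rat_poly_scale p.
have int_p i : a%:~R * (minCpoly z)`_i \in Num.int.
  rewrite Dp Dq coef_map coefZ coef_map /= rmorphM /= fmorphV /= !ratr_int.
  by rewrite mulVKf ?intr_eq0 // intr_int.
exists a%:~R; first by rewrite intr_int intr_eq0.
set c := minCpoly z in int_p; set b : algC := a%:~R in int_p *.
have mon_c : c \is monic := minCpoly_monic z.
have [n sz_c] : exists n, size c = n.+1.
  by exists (size c).-1; rewrite prednK // (ltn_trans _ (size_minCpoly z)).
have c_n : c`_n = 1 by move: (monicP mon_c); rewrite lead_coefE sz_c.
apply: (@root_monic_Aint (\poly_(i < n.+1) (b ^+ (n - i) * c`_i))).
- rewrite rootE horner_poly; suff -> : forall y, \sum_(i < n.+1)
      b ^+ (n - i) * c`_i * (b * y) ^+ i = b ^+ n * c.[y].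
    by rewrite (rootP (root_minCpoly z)) mulr0.
  move=> y; rewrite horner_coef sz_c mulr_sumr; apply: eq_bigr => i _.
  rewrite exprMn mulrACA -exprD subnK ?mulrA //.
  by rewrite -ltnS.
- rewrite monicE lead_coefE size_poly_eq.
    by rewrite coef_poly ltnSn subnn expr0 mul1r c_n.
  by rewrite subnn expr0 mul1r c_n oner_eq0.
- apply/polyOverP => i; rewrite coef_poly.
  case: ltnP => [lt_in|_]; last by rewrite rpred0.
  have [->|ne_in] := eqVneq i n; first by rewrite subnn expr0 mul1r c_n rpred1.
  have lt0 : (0 < n - i)%N by rewrite subn_gt0 ltn_neqAle ne_in -ltnS.
  by rewrite -(prednK lt0) exprSr -mulrA rpredM ?rpredX ?intr_int.
Qed.

Lemma modp_minCpoly x :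
  exists2 p : {poly rat}, forall f, (size (f %% p)%R < size (minCpoly x))%N &
    forall f, (pQtoC (f %% p)).[x] = (pQtoC f).[x].
Proof.
have [p [Dp mon_p] _] := minCpolyP x; exists p => f.
  by rewrite Dp size_map_poly ltn_modp monic_neq0.
rewrite [in RHS](divp_eq f p) rmorphD rmorphM /= hornerD hornerM -Dp.
by rewrite (rootP (root_minCpoly x)) mulr0 add0r.
Qed.

(** * Simultaneous Diophantine approximation *)

Lemma dirichlet_approximation k (q : nat -> algC) N :
    (0 < N)%N -> (forall i, (i < k)%N -> q i \is Num.real) ->
  exists n (p : nat -> int), (0 < n)%N /\
    forall i, (i < k)%N -> `|n%:R * q i - (p i)%:~R| < N%:R^-1.
Proof.
case: N => // N _ q_real.
pose fr (n i : nat) : algC := n%:R * q i - (Num.floor (n%:R * q i))%:~R.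
pose b (n i : nat) := Num.floor (N.+1%:R * fr n i).
have nq_real n i : (i < k)%N -> n%:R * q i \is Num.real.
  by move=> /q_real; apply: rpredM; rewrite realn.
have fr_itv n i : (i < k)%N -> 0 <= fr n i < 1.
  move=> /(nq_real n) /real_floor_itv; rewrite subr_ge0 ltrBlDl.
  by rewrite rmorphD /= addrC.
have fr_real n i : (i < k)%N -> N.+1%:R * fr n i \is Num.real.
  by move=> /(fr_itv n) /andP[fr0 _]; rewrite rpredM ?realn ?ger0_real.
have b_itv n i : (i < k)%N -> 0 <= b n i < N.+1%:Z.
  move=> ki; have /andP[fr0 fr1] := fr_itv n i ki.
  rewrite real_floor_ge0 ?fr_real // mulr_ge0 ?ler0n //=.
  rewrite real_floor_lt_int ?fr_real // -pmulrn -[ltRHS]mulr1.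
  by rewrite ltr_pM2l ?ltr0n.
(* Pigeonhole: [F] gives the box of side [1 / N.+1] that contains the fractional parts of the
   [n * q i], and there is one more [n] than boxes. The difference of two indices sharing a box is
   the required multiplier. *)
pose F (n : 'I_(N.+1 ^ k).+1) := [ffun i : 'I_k => inord `|b n i|%N : 'I_N.+1].
have /injectivePn[n1 [n2 n12 F12]] : ~~ injectiveb F.
  apply/negP => /injectiveP /leq_card.
  by rewrite card_ffun !card_ord ltnn.
wlog lt12 : n1 n2 n12 F12 / (n1 < n2)%N.
  move=> wl; case: (ltngtP n1 n2) => [||/val_inj e]; first exact: wl.
    by apply: wl; rewrite 1?eq_sym.
  by rewrite e eqxx in n12.
exists (n2 - n1)%N, (fun i => Num.floor (n2%:R * q i) - Num.floor (n1%:R * q i)).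
split=> [|i ki]; first by rewrite subn_gt0.
have b12 : b n1 i = b n2 i.
  have /ffunP/(_ (Ordinal ki)) := F12; rewrite !ffunE /= => /(congr1 val) /=.
  have itv n : (`|b n i| < N.+1)%N.
    by have /andP[b0 b1] := b_itv n i ki; rewrite -ltz_nat gez0_abs.
  have abs_b n : `|b n i|%N = b n i :> int.
    by have /andP[b0 _] := b_itv n i ki; rewrite gez0_abs.
  by rewrite !inordK // => /(congr1 Posz); rewrite !abs_b.
have -> : (n2 - n1)%:R * q i -
    (Num.floor (n2%:R * q i) - Num.floor (n1%:R * q i))%:~R = fr n2 i - fr n1 i.
  by rewrite natrB 1?ltnW // mulrBl rmorphB /= /fr !opprD !opprK addrACA.
rewrite -(@ltr_pM2l _ N.+1%:R) ?ltr0n // mulfV ?pnatr_eq0 //.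
rewrite -{1}[N.+1%:R]normr_nat -normrM mulrBr.
have /andP[l1 h1] := real_floor_itv (fr_real n1 i ki).
have /andP[l2 h2] := real_floor_itv (fr_real n2 i ki).
rewrite real_ltr_norml ?rpredB ?fr_real //.
rewrite -/(b n1 i) -/(b n2 i) b12 rmorphD /= in l1 h1 l2 h2.
rewrite ltrBlDr ltrBrDl; apply/andP; split.
  rewrite ltrBlDr; apply: lt_le_trans h1 _.
  by rewrite lerD2r.
by apply: lt_le_trans h2 _; rewrite addrC lerD2l.
Qed.

(** One constant serves all points of [r] and all polynomials, so the coefficient precision can be
    chosen after it. The summand 1 in the witness keeps it positive when [r] is empty. *)
Lemma horner_bound (r : seq algC) d :
  exists2 C : algC, 0 < C & forall z (g : {poly algC}) e, z \in r ->
    (size g <= d)%N -> 0 <= e -> (forall j, (j < d)%N -> `|g`_j| <= e) ->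
    `|g.[z]| <= C * e.
Proof.
pose S (z : algC) : algC := \sum_(j < d) `|z| ^+ j.
have S0 z : 0 <= S z by rewrite sumr_ge0 // => j _; rewrite exprn_ge0.
exists (1 + \sum_(z <- r) S z).
  by rewrite ltr_pwDl // sumr_ge0.
move=> z g e rz sz_g e0 ge.
have le_gz : `|g.[z]| <= S z * e.
  rewrite (horner_coef_wide _ sz_g) mulr_suml; apply: le_trans (ler_norm_sum _ _ _) _.
  apply: ler_sum => j _; rewrite normrM normrX mulrC ler_wpM2l ?exprn_ge0 //.
  exact: ge.
apply: le_trans le_gz _; rewrite ler_wpM2r // (big_rem z) //=.
by rewrite addrCA lerDl addr_ge0 ?sumr_ge0.
Qed.

(** * Subfields of the algebraic numbers and integral primitive elements *)

Section Subfield.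

Variable F : algC -> Prop.
Hypothesis hF : is_subfield F.

Lemma subfieldN x : F x -> F (- x).
Proof. by case: hF => F0 _ FB _ _ Fx; rewrite -sub0r; apply: FB. Qed.

Lemma subfieldD x y : F x -> F y -> F (x + y).
Proof.
by case: hF => _ _ FB _ _ Fx Fy; rewrite -[y]opprK; apply: FB => //; apply: subfieldN.
Qed.

Lemma subfieldM x y : F x -> F y -> F (x * y).
Proof. by case: hF => _ _ _ FM _; apply: FM. Qed.

Lemma subfieldV x : F x -> F x^-1.
Proof.
case: hF => F0 _ _ _ FV Fx; have [->|] := eqVneq x 0; first by rewrite invr0.
exact: FV.
Qed.

Lemma subfield_sum (I : Type) (r : seq I) (P : pred I) (E : I -> algC) :
  (forall i, P i -> F (E i)) -> F (\sum_(i <- r | P i) E i).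
Proof.
move=> FE; elim/big_ind: _ => //; last exact: subfieldD.
by case: hF.
Qed.

Lemma subfield_nat n : F n%:R.
Proof.
case: hF => F0 F1 _ _ _; elim: n => // n IHn.
by rewrite -addn1 natrD; apply: subfieldD.
Qed.

Lemma subfield_int (n : int) : F n%:~R.
Proof.
by case: n => n; rewrite ?NegzE ?rmorphN; [|apply: subfieldN]; apply: subfield_nat.
Qed.

Lemma subfield_rat a : F (ratr a).
Proof. by apply: subfieldM; [|apply: subfieldV]; apply: subfield_int. Qed.

Lemma subfield_horner (f : {poly rat}) x : F x -> F (pQtoC f).[x].
Proof.
move=> Fx; elim/poly_ind: f => [|f a Ff].
  by rewrite rmorph0 horner0; apply: (subfield_int 0).
rewrite rmorphD rmorphM /= map_polyX map_polyC hornerMXaddC.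
by apply: subfieldD; [apply: subfieldM | apply: subfield_rat].
Qed.

End Subfield.

Lemma primitive_element (K : algC -> Prop) : real_number_field K ->
  exists g, [/\ K g, g \in Aint &
    forall x, K x -> exists f : {poly rat}, x = (pQtoC f).[g]].
Proof.
case=> hK _ [s [sK spanK]].
have [z [a Dz] [ps Ds]] := algC_PET s.
have s_nth j : (j < size s)%N -> s`_j = (pQtoC ps`_j).[z].
  by move=> lt_j; rewrite {1}Ds (nth_map 0) // -(size_map (fun p => (pQtoC p).[z])) -Ds.
have Kz : K z.
  rewrite Dz; apply: subfield_sum => // i _; rewrite -mulr_natr.
  by apply: subfieldM => //; [apply: sK; rewrite mem_nth | apply: subfield_nat].
have [b [/intrP[m Db] nz_b] Abz] := exists_Aint_multiple z.
exists (b * z); split=> // [|x Kx].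
  by apply: subfieldM => //; rewrite Db; apply: subfield_int.
have [c ->] := spanK x Kx.
(* Substituting [X / m] turns a polynomial in [z] into one in the integral generator [m * z]. *)
pose f := \sum_(i < size s) c`_i *: (ps`_i \Po (m%:~R^-1 *: 'X)).
exists f; rewrite rmorph_sum horner_sum; apply: eq_bigr => i _.
rewrite s_nth //= map_polyZ hornerZ map_comp_poly horner_comp.
rewrite map_polyZ map_polyX hornerZ hornerX fmorphV /= ratr_int -Db mulKf //.
Qed.

Lemma ler_prod_norm (s : seq algC) B :
  0 <= B -> (forall z, z \in s -> `|z| <= B) ->
  \prod_(z <- s) `|z| <= B ^+ size s.
Proof.
move=> B0; elim: s => [|z s IHs] leB; first by rewrite big_nil.
rewrite big_cons exprS ler_pM ?prodr_ge0 //; first by rewrite leB ?mem_head.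
by apply: IHs => y sy; rewrite leB // inE sy orbT.
Qed.

(** * Integers of [K] with prescribed approximate conjugates *)

Section PrimitiveElement.

Variables (K : algC -> Prop) (g : algC).
Hypotheses (hK : is_subfield K) (K_real : forall x, K x -> x \is Num.real).
Hypotheses (Kg : K g) (Ag : g \in Aint).
Hypothesis genK : forall x, K x -> exists f : {poly rat}, x = (pQtoC f).[g].

Implicit Type u : {rmorphism algC -> algC}.

(** This is the degree of [K] over Q. *)
Let d := (size (minCpoly g)).-1.

Let size_minCpoly_g : size (minCpoly g) = d.+1.
Proof. by rewrite prednK // (ltn_trans _ (size_minCpoly g)). Qed.

Let d_gt0 : (0 < d)%N.
Proof. by rewrite -ltnS -size_minCpoly_g size_minCpoly. Qed.

Lemma aut_fix x u : K x -> u g = g -> u x = x.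
Proof. by case/genK=> f -> ug; rewrite aut_horner_ratr ug. Qed.

Lemma horner_eq0_size (f : {poly rat}) :
  (size f <= d)%N -> (pQtoC f).[g] = 0 -> f = 0.
Proof.
have [p [Dp _] dv_p] := minCpolyP g.
move=> sz_f /rootP; rewrite dv_p => dvd_f; apply/eqP/negPn/negP => nz_f.
have := dvdp_leq nz_f dvd_f.
rewrite -(size_map_poly (ratr : {rmorphism rat -> algC})) -Dp size_minCpoly_g.
by rewrite leqNgt ltnS sz_f.
Qed.

Lemma reduced_rep x : K x ->
  exists2 f : {poly rat}, (size f <= d)%N & x = (pQtoC f).[g].
Proof.
case/genK=> f ->; have [p sz_mod modE] := modp_minCpoly g.
by exists (f %% p); rewrite ?modE // -ltnS -size_minCpoly_g.
Qed.

(** The product of the conjugates of [y] is a nonzero integer. At most [d - 1] of them differ from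
    [y], and each of these is [u y] with [u] nontrivial; [B >= 1] allows the exponent [d]. *)
Lemma norm_lower_bound y B : K y -> y \in Aint -> y != 0 -> 1 <= B ->
  (forall u, u g != g -> `|u y| <= B) -> 1 <= `|y| * B ^+ d.
Proof.
move=> Ky Ay nz_y B1 leB.
have [r Dr Ur] := minCpoly_roots y; have [rg Drg Urg] := minCpoly_roots g.
have mem_r z : (z \in r) = root (minCpoly y) z by rewrite Dr root_prod_XsubC.
have ry : y \in r by rewrite mem_r root_minCpoly.
have [f Df] := genK _ Ky.
(* Writing [y] as [f] evaluated at [g], every conjugate of [y] is [f] evaluated at a conjugate of
   [g]. *)
have sz_r : (size r <= d)%N.
  have -> : d = size (map (fun z => (pQtoC f).[z]) rg).
    by rewrite size_map /d Drg size_prod_XsubC.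
  apply: uniq_leq_size => // z; rewrite mem_r => /exists_aut_of_root[u <-].
  rewrite {1}Df aut_horner_ratr map_f // -root_prod_XsubC -Drg.
  exact: root_minCpoly_aut.
have nz_prod : \prod_(z <- r) z != 0.
  rewrite prodf_seq_neq0; apply/allP => z; rewrite mem_r.
  by case/exists_aut_of_root=> u <-; rewrite fmorph_eq0.
have int_prod : \prod_(z <- r) z \in Num.int.
  have /polyOverP/(_ 0%N) : minCpoly y \is a polyOver Num.int by [].
  rewrite Dr coef0_prod_XsubC => H.
  rewrite -[X in X \in _](signrMK (size r)) rpredM //.
  by rewrite rpredX ?rpredN ?rpred1.
have := norm_intr_ge1 int_prod nz_prod.
rewrite normr_prod (big_rem y) //= => /le_trans; apply.
rewrite ler_wpM2l //.
have leB' z : z \in rem y r -> `|z| <= B.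
  rewrite mem_rem_uniq // inE => /andP[zy]; rewrite mem_r.
  case/exists_aut_of_root=> u Du; rewrite -Du; apply: leB.
  by apply: contraNneq zy => ug; rewrite -Du (aut_fix _ _ Ky ug).
have B0 : 0 <= B := le_trans ler01 B1.
apply: le_trans (ler_prod_norm _ _ B0 leB') _.
by rewrite ler_weXn2l // size_rem // (leq_trans (leq_pred _)).
Qed.

Lemma exists_small (e : algC) : 0 < e -> exists y,
  [/\ K y, y \in Aint, y != 0 & forall u, u g != g -> `|u y| < e].
Proof.
move=> e0.
have [rg Drg Urg] := minCpoly_roots g.
have [C C0 leC] := horner_bound rg d.
have /factor_theorem[Q DQ] := root_minCpoly g.
have mon_Q : Q \is monic.
  by rewrite -(monicMr _ (monicXsubC g)) -DQ minCpoly_monic.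
have sz_Q : size Q = d.
  by rewrite /d DQ size_Mmonic ?monic_neq0 ?monicXsubC // size_XsubC addn2.
(* Complex conjugation fixes both [minCpoly g] and ['X - g%:P], hence their quotient. *)
have Q_real i : Q`_i \is Num.real.
  suff /(congr1 (fun h : {poly algC} => h`_i)) : map_poly Num.conj Q = Q.
    by rewrite coef_map => /CrealP.
  have nzX : 'X - g%:P != 0 by rewrite polyXsubC_eq0.
  apply: (mulIf nzX); rewrite -DQ.
  have [p [Dp _] _] := minCpolyP g.
  transitivity (map_poly Num.conj (minCpoly g)).
    rewrite DQ rmorphM /= map_polyXsubC /=.
    by rewrite (CrealP (K_real _ Kg)).
  rewrite Dp -map_poly_comp; apply: eq_map_poly => a /=.
  by rewrite conj_Crat // Crat_rat.
have Ce0 : 0 <= C / e by rewrite divr_ge0 // ltW.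
pose N := (Num.bound (C / e)).
have N0 : (0 < N)%N by rewrite -(ltr_nat algC) (le_lt_trans Ce0) // archi_boundP.
have CN : C * N%:R^-1 < e.
  by rewrite ltr_pdivrMr ?ltr0n // mulrC -ltr_pdivrMr // archi_boundP.
have [n [p [n0 Hp]]] :=
  dirichlet_approximation d (fun i => Q`_i) N N0 (fun i _ => Q_real i).
pose P : {poly rat} := \poly_(i < d) (p i)%:~R.
have sz_P : (size P <= d)%N by apply: size_poly.
have coefP i : (i < d)%N -> (pQtoC P)`_i = (p i)%:~R.
  by move=> id; rewrite coef_map coef_poly id /= ratr_int.
exists (pQtoC P).[g]; split.
- exact: subfield_horner.
- rewrite (@horner_coef_wide _ d) ?size_map_poly //.
  by apply: rpred_sum => i _; rewrite coefP // rpredM ?rpredX ?Aint_int.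
(* As [Q] is monic of degree [d - 1], its top coefficient is 1; if [P] were 0, the approximation
   there would give [n < N^-1 <= 1]. *)
- apply/eqP => /(horner_eq0_size _ sz_P) P0.
  have d1 : (d.-1 < d)%N by rewrite prednK.
  have := Hp _ d1; have := coefP _ d1; rewrite P0 rmorph0 coef0 => <-.
  rewrite -sz_Q -lead_coefE (monicP mon_Q) mulr1 subr0 normr_nat.
  have N1 : N%:R^-1 <= 1 :> algC by rewrite invf_le1 ?ler1n ?ltr0n.
  by move=> /lt_le_trans /(_ N1);
    rewrite (ltr_nat _ n 1) ltnS leqn0 -[_ == _]negbK -lt0n n0.
move=> u ug; rewrite aut_horner_ratr.
(* [Q] vanishes at every conjugate of [g] other than [g], so subtracting [n *: Q] leaves the value
   at [u g] unchanged and makes all coefficients small. *)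
have Qu : Q.[u g] = 0.
  have := rootP (root_minCpoly_aut u g); rewrite DQ hornerM hornerXsubC.
  by move/eqP; rewrite mulf_eq0 subr_eq0 (negPf ug) orbF => /eqP.
have -> : (pQtoC P).[u g] = (pQtoC P - n%:R *: Q).[u g].
  by rewrite !hornerE Qu mulr0 subr0.
apply: le_lt_trans CN; apply: leC.
- by rewrite -root_prod_XsubC -Drg root_minCpoly_aut.
- rewrite (leq_trans (size_polyD _ _)) // geq_max size_map_poly sz_P size_polyN.
  by rewrite (leq_trans (size_scale_leq _ _)) ?sz_Q.
- by rewrite invr_ge0 ler0n.
by move=> j jd; rewrite coefB coefP // coefZ distrC ltW // Hp.
Qed.

(** If all the [u y] have modulus at most 1, the norm bound forces [1 <= |y|]; squaring makes [y]
    positive and an integer factor [m > M] makes it large. *)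
Lemma exists_small_large (e M : algC) : 0 < e -> M \is Num.real -> exists y,
  [/\ K y, y \in Aint, M < y & forall u, u g != g -> `|u y| < e].
Proof.
move=> e0 M_real; pose m := (Num.bound M).+1.
have m0 : 0 < m%:R :> algC by rewrite ltr0n.
have Mm : M < m%:R.
  have [M0|M0] := real_ge0P M_real; last exact: lt_trans m0.
  by rewrite (lt_trans (archi_boundP M0)) // ltr_nat.
have e1 : 0 < 1 + e by rewrite addr_gt0.
have e1' : e / (1 + e) <= 1 by rewrite ler_pdivrMr // mul1r lerDr ler01.
have e2' : e / (1 + e) <= e.
  by rewrite ler_pdivrMr // mulrDr mulr1 lerDl mulr_ge0 // ltW.
(* This makes [e' <= 1] and [m * e' <= e], so that [m * |u y| ^ 2 <= m * |u y| < e]. *)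
pose e' := e / (1 + e) / m%:R.
have e'0 : 0 < e' by rewrite !divr_gt0.
have e'1 : e' <= 1.
  by rewrite ler_pdivrMr // mul1r (le_trans e1') // ler1n.
have [y [Ky Ay nz_y small_y]] := exists_small e' e'0.
have y1 : 1 <= `|y|.
  have := norm_lower_bound y 1 Ky Ay nz_y (lexx 1).
  rewrite expr1n mulr1; apply=> u /small_y /ltW /le_trans; exact.
exists (m%:R * y ^+ 2); split.
- by apply: subfieldM => //; [apply: subfield_nat | apply: subfieldM].
- by rewrite rpredM ?rpredX ?rpred_nat.
- apply: lt_le_trans Mm _; rewrite ler_peMr ?ler0n //.
  by rewrite -real_normK ?K_real // exprn_ege1.
move=> u ug; rewrite rmorphM rmorphXn rmorph_nat normrM normrX normr_nat.
have uy := small_y u ug.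
rewrite mulrC -ltr_pdivlMr //.
apply: (@le_lt_trans _ _ `|u y|).
  by rewrite expr2 ler_piMr // (le_trans (ltW uy)).
by apply: lt_le_trans uy _; rewrite ler_wpM2r // invr_ge0 ler0n.
Qed.

Lemma approximation x (e M : algC) : K x -> 0 < e -> M \is Num.real ->
  exists a, [/\ K a, a \in Aint, M < a &
    forall u, u g != g -> `|u a - u x| < e].
Proof.
move=> Kx e0 M_real.
have [rg Drg _] := minCpoly_roots g; have [C C0 leC] := horner_bound rg d.
have e2 : 0 < e / 2 by rewrite divr_gt0 ?ltr0n.
(* Rounding down the coordinates of [x / y] costs at most [C] at each conjugate, hence less than
   [e / 2] after multiplication by [u y]. The other [e / 2] is left for the summand [z] that pushes
   the result above [M]. *)
have [y [Ky Ay y0 small_y]] :=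
  exists_small_large (e / 2 / C) 0 (divr_gt0 e2 C0) (real0 _).
have [f sz_f Df] := reduced_rep (x / y) (subfieldM _ hK _ _ Kx (subfieldV _ hK _ Ky)).
pose P : {poly rat} := \poly_(i < d) (Num.floor f`_i)%:~R.
have sz_P : (size P <= d)%N by apply: size_poly.
pose b := (pQtoC P).[g].
have Kb : K b by apply: subfield_horner.
have Ab : b \in Aint.
  rewrite /b (@horner_coef_wide _ d) ?size_map_poly //.
  apply: rpred_sum => i _; rewrite coef_map coef_poly ltn_ord /= ratr_int.
  by rewrite rpredM ?rpredX ?Aint_int.
have Kyb : K (y * b) by apply: subfieldM.
have [z [Kz Az z0 small_z]] :=
  exists_small_large (e / 2) (M - y * b) e2 (rpredB M_real (K_real _ Kyb)).
exists (y * b + z); split.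
- exact: subfieldD.
- by rewrite rpredD ?rpredM.
- by rewrite -ltrBlDl.
move=> u ug.
have Dx : x = y * (pQtoC f).[g] by rewrite -Df mulrC divfK // gt_eqF.
rewrite {1}Dx rmorphD !rmorphM /= !aut_horner_ratr addrAC -mulrBr.
apply: le_lt_trans (ler_normD _ _) _.
have -> : e = e / 2 + e / 2 by rewrite -splitr.
rewrite ltrD ?small_z // normrM.
apply: (@le_lt_trans _ _ (`|u y| * C)); last by rewrite -ltr_pdivlMr ?small_y.
rewrite ler_wpM2l // -hornerN -hornerD -rmorphB /= -[leRHS]mulr1 leC //.
- by rewrite -root_prod_XsubC -Drg root_minCpoly_aut.
- rewrite size_map_poly (leq_trans (size_polyD _ _)) // geq_max sz_P.
  by rewrite size_polyN.
move=> j jd; rewrite coef_map coefB coef_poly jd /= -ratr_norm.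
rewrite -[leRHS](rmorph1 (ratr : {rmorphism rat -> algC})).
have /andP[l1 l2] := floor_itv f`_j; rewrite ler_rat distrC ger0_norm ?subr_ge0 //.
by rewrite lerBlDl ltW // (lt_le_trans l2) // rmorphD.
Qed.

(** * Characterization of [wp K] by nontrivial automorphisms *)

Lemma wp_conj_lt1 x u : wp K x -> u g != g -> `|u x| < 1.
Proof.
case=> Kx [_ _ _ conj_x] gen_x ug; apply: conj_x; first exact: root_minCpoly_aut.
apply: contraNneq ug => ux; apply/eqP.
have /gen_x gx : K g by [].
(* The fixed field of [u] contains [x], hence also [g], which lies in Q([x]). *)
apply: (gx (fun w => u w = w)) => //.
split=> [||y z|y z|y uy _]; rewrite ?rmorph0 ?rmorph1 //.
- by rewrite rmorphB /= => -> ->.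
- by rewrite rmorphM /= => -> ->.
- by rewrite fmorphV /= uy.
Qed.

(** An automorphism moving [x] moves [g], which gives the Pisot property. That [x] generates [K]
    follows by counting conjugates, then by linear algebra. *)
Lemma conj_lt1_wp x : K x -> x \in Aint -> 1 < x ->
  (forall u, u g != g -> `|u x| < 1) -> wp K x.
Proof.
move=> Kx Ax x1 small_x; have x_real := K_real _ Kx.
split=> //.
  split=> // z /exists_aut_of_root[u <-] ux; apply: small_x.
  by apply: contraNneq ux => ug; rewrite (aut_fix _ _ Kx ug).
move=> y; split=> [gy|Ky]; first exact: gy.
suff [h Dg] : exists h : {poly rat}, g = (pQtoC h).[x].
  move=> F hF Fx; have [f ->] := genK _ Ky.
  by apply: subfield_horner => //; rewrite Dg; apply: subfield_horner.
have [f Df] := genK _ Kx; have [p ltn_mod modE] := modp_minCpoly g.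
have sz_mod (q : {poly rat}) : (size (q %% p)%R <= d)%N.
  by rewrite -ltnS -size_minCpoly_g.
have [rg Drg Urg] := minCpoly_roots g; have [rx Drx Urx] := minCpoly_roots x.
have sz_x : (d < size (minCpoly x))%N.
  rewrite Drx size_prod_XsubC ltnS.
  have -> : d = size (map (fun z => (pQtoC f).[z]) rg).
    by rewrite size_map /d Drg size_prod_XsubC.
  apply: uniq_leq_size => [|_ /mapP[z rz ->]]; last first.
    have [u <-] : {u : {rmorphism algC -> algC} | u g = z}.
      by apply: exists_aut_of_root; rewrite Drg root_prod_XsubC.
    by rewrite -aut_horner_ratr -Df -root_prod_XsubC -Drx root_minCpoly_aut.
  (* If u1 x = u2 x then u1^-1 u2 fixes x, hence g, as |x| > 1. *)
  rewrite map_inj_in_uniq // => z1 z2; rewrite -!root_prod_XsubC -Drg.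
  move=> /exists_aut_of_root[u1 <-] /exists_aut_of_root[u2 <-].
  rewrite -!aut_horner_ratr -Df => u12.
  pose w : {rmorphism algC -> algC} := algC_invaut u1 \o u2.
  have wx : w x = x by rewrite /w /= -u12 algC_autK.
  have wg : w g = g.
    apply/eqP/negPn/negP => /small_x; rewrite wx ger0_norm; last first.
      by rewrite ltW // (lt_trans ltr01).
    by move/(lt_trans x1); rewrite ltxx.
  by rewrite -[in LHS]wg /w /= algC_invautK.
(* As x has d conjugates, its first d powers are independent, and A expresses
   them in the basis of the powers of g. *)
pose A : 'M[rat]_d := \matrix_i poly_rV (f ^+ i %% p).
have evA v : (pQtoC (rVpoly v)).[x] = (pQtoC (rVpoly (v *m A))).[g].
  rewrite (@horner_coef_wide _ d); last by rewrite size_map_poly size_poly.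
  rewrite mulmx_sum_row linear_sum /= rmorph_sum horner_sum.
  apply: eq_bigr => i _; rewrite rowK linearZ /= poly_rV_K ?sz_mod //.
  rewrite map_polyZ hornerZ modE rmorphXn horner_exp -Df coef_map.
  by rewrite coef_rVpoly_ord.
have freeA : row_free A.
  apply: inj_row_free => v vA; apply: (can_inj rVpolyK); rewrite linear0.
  have [q [Dq _] dv_q] := minCpolyP x.
  have /rootP : (pQtoC (rVpoly v)).[x] = 0 by rewrite evA vA linear0 rmorph0 horner0.
  rewrite dv_q => dvd_v; apply/eqP/negPn/negP => nz_v.
  have := dvdp_leq nz_v dvd_v; rewrite leqNgt; apply/negP/negPn.
  rewrite -(size_map_poly (ratr : {rmorphism rat -> algC}) q) -Dq.
  by rewrite (leq_ltn_trans _ sz_x) // size_poly.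
(* Solve for the coordinates of [g]. Reducing ['X] modulo [p] matters when [d] is 1, where ['X]
   itself does not fit in a row of length [d]. *)
exists (rVpoly (poly_rV ('X %% p) *m invmx A)).
rewrite evA mulmxKV -?row_free_unit // poly_rV_K ?sz_mod // modE.
by rewrite map_polyX hornerX.
Qed.

(** * A sufficient condition for membership in [DK K] *)

Lemma DK_of_conj_le y : K y -> y \in Aint -> 0 < y ->
  (forall u, u g != g -> `|u y| <= 7 / 4) -> DK K y.
Proof.
move=> Ky Ay y0 le_y.
have K2 : K (- y / 2).
  apply: subfieldM => //; first exact: subfieldN.
  by apply: subfieldV => //; apply: subfield_nat.
have e0 : 0 < 8^-1 :> algC by rewrite invr_gt0 ltr0n.
(* Both [u a] and [u (a + y)] are within 1/8 of [-+ u y / 2], whose modulus is at most 7/8. *)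
have [a [Ka Aa a1 near_a]] := approximation _ _ 1 K2 e0 (real1 _).
have E : 1 = 8^-1 + 7 / 8 :> algC.
  by rewrite -{1}[8^-1]mul1r -mulrDl -(natrD _ 1 7) divff ?pnatr_eq0.
have le_y2 u : u g != g -> `|u y / 2| <= 7 / 8.
  move=> /le_y le_uy; rewrite normrM normfV normr_nat.
  have -> : 8 = 4 * 2 :> algC by rewrite -natrM.
  by rewrite invfM mulrA ler_wpM2r // invr_ge0 ler0n.
have eq_u u : u (- y / 2) = - (u y / 2).
  by rewrite fmorph_div /= rmorphN rmorph_nat mulNr.
have wp_a : wp K a.
  apply: conj_lt1_wp => // u ug.
  rewrite -[u a](subrK (u (- y / 2))) (le_lt_trans (ler_normD _ _)) //.
  by rewrite [ltRHS]E ltr_leD ?near_a // eq_u normrN le_y2.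
exists (a + y), a; split=> //.
- apply: conj_lt1_wp; first exact: subfieldD.
  + by rewrite rpredD.
  + by rewrite (lt_trans a1) // ltrDl.
  move=> u ug.
  have -> : u (a + y) = (u a - u (- y / 2)) + u y / 2.
    rewrite eq_u opprK rmorphD /= -addrA; congr (_ + _).
    exact: splitr.
  by rewrite (le_lt_trans (ler_normD _ _)) // [ltRHS]E ltr_leD ?near_a // le_y2.
- by rewrite ltrDl.
- by rewrite addrAC subrr add0r.
Qed.

(** Otherwise [g] is the only root of its separable minimal polynomial, which is then [X - g], so
    [g] is rational and [K] is Q. *)
Lemma exists_nontrivial_aut :
  ~ (forall x, K x <-> x \in Crat) -> exists u, u g != g.
Proof.
move=> notQ; have [r Dr Ur] := minCpoly_roots g.
have [/hasP[z rz zg]|/hasPn all_g] := boolP (has (predC1 g) r).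
  have /exists_aut_of_root[u uz] : root (minCpoly g) z.
    by rewrite Dr root_prod_XsubC.
  by exists u; rewrite uz.
suff g_rat : g \in Crat.
  case: notQ => x; split=> [|/CratP[a ->]]; last exact: subfield_rat.
  have [v Dv] := CratP _ g_rat; case/genK=> f ->.
  by rewrite Dv horner_map Crat_rat.
have Dr1 : r = [:: g].
  have rg : g \in r by rewrite -root_prod_XsubC -Dr root_minCpoly.
  apply: perm_small_eq => //; apply: uniq_perm => // z; rewrite inE.
  by apply/idP/eqP => [/all_g|-> //]; rewrite /= negbK => /eqP.
have [p [Dp _] _] := minCpolyP g.
have /(congr1 (fun h : {poly algC} => h`_0)) := Dp.
rewrite Dr Dr1 big_seq1 coefB coefX coefC coef_map /= sub0r => /eqP.
by rewrite eqr_oppLR -rmorphN => /eqP ->; apply: Crat_rat.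
Qed.

(** * Discreteness of [wp K] and successors *)

Lemma wp_gap a b : wp K a -> wp K b -> a < b -> 1 <= (b - a) * 2 ^+ d.
Proof.
move=> wa wb ab; have [Ka [_ _ Aa _] _] := wa; have [Kb [_ _ Ab _] _] := wb.
have ba0 : 0 < b - a by rewrite subr_gt0.
rewrite -[b - a]ger0_norm ?(ltW ba0) // norm_lower_bound ?rpredB ?gt_eqF //.
- by apply: subfieldD => //; apply: subfieldN.
- by rewrite ler1n.
move=> u ug; rewrite rmorphB (le_trans (ler_normB _ _)) //.
by rewrite -[2]/(1 + 1) lerD // ltW // wp_conj_lt1.
Qed.

Lemma wp_unbounded M : M \is Num.real -> 1 <= M -> exists2 b, wp K b & M < b.
Proof.
move=> M_real M1; have K0 := subfield_nat _ hK 0.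
have [b [Kb Ab Mb small_b]] := approximation _ _ _ K0 ltr01 M_real.
exists b => //; apply: conj_lt1_wp => //; first exact: le_lt_trans Mb.
by move=> u /small_b; rewrite rmorph0 subr0.
Qed.

(** Descent on an integer bound for [(b - a) * 2 ^+ d]: replacing [b] by an element of [wp K]
    strictly between lowers this quantity by at least 1, by [wp_gap]. *)
Lemma FK_successor a : wp K a -> exists2 b, wp K b & FK K (b - a).
Proof.
move=> wa; have [Ka [a_real a1 _ _] _] := wa.
suff succ n b : wp K b -> a < b -> (b - a) * 2 ^+ d <= n%:R ->
    exists2 b, wp K b & FK K (b - a).
  have [b wb ab] := wp_unbounded _ a_real (ltW a1).
  have pos : 0 <= (b - a) * 2 ^+ d := le_trans ler01 (wp_gap _ _ wa wb ab).
  exact: succ wb ab (ltW (archi_boundP pos)).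
elim: n b => [|n IHn] b wb ab le_n.
  by have := le_trans (wp_gap _ _ wa wb ab) le_n; rewrite ler10.
have [[c [wc ac cb]]|no_c] := classic (exists c, [/\ wp K c, a < c & c < b]).
  apply: (IHn c wc ac); rewrite -(lerD2r 1) natr1 (le_trans _ le_n) //.
  by rewrite -[b - a](subrKA c) [leLHS]addrC [leRHS]mulrDl lerD2r wp_gap.
exists b => //; exists b, a; split=> // c wc [ac cb].
by apply: no_c; exists c.
Qed.

(** * The assertions on [DK K] and [FK K] *)

Lemma DK1 : DK K 1.
Proof.
apply: DK_of_conj_le; [by case: hK | exact: Aint1 | exact: ltr01 |].
move=> u _; rewrite rmorph1 normr1 ler_pdivlMr ?ltr0n // mul1r.
by rewrite ler_nat.
Qed.

Lemma wp_sub_DK x : wp K x -> DK K x.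
Proof.
move=> wx; have [Kx [_ x1 Ax _] _] := wx.
apply: DK_of_conj_le => //; first exact: lt_trans x1.
move=> u ug; rewrite (le_trans (ltW (wp_conj_lt1 _ _ wx ug))) //.
by rewrite ler_pdivlMr ?ltr0n // mul1r ler_nat.
Qed.

(** Conjugates within 1/4 of 3/2 have modulus at most 7/4, which puts [y] in [DK K], but more than
    1, which keeps it out of [wp K]. Such [y] exist above the sum [M] of the moduli of any finite
    list. *)
Lemma DK_minus_wp_infinite u :
  u g != g -> infinite_set (fun x => DK K x /\ ~ wp K x).
Proof.
move=> ug [s sub_s]; pose M : algC := \sum_(z <- s) `|z|.
have M0 : 0 <= M by rewrite sumr_ge0.
have K32 : K (3 / 2).
  by apply: subfieldM => //; [|apply: subfieldV => //]; apply: subfield_nat.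
have e0 : 0 < 4^-1 :> algC by rewrite invr_gt0 ltr0n.
have [y [Ky Ay My near_y]] := approximation _ _ _ K32 e0 (ger0_real M0).
have y0 := le_lt_trans M0 My.
have {}near_y (v : {rmorphism algC -> algC}) : v g != g -> `|v y - 3 / 2| < 4^-1.
  by move=> /near_y; rewrite fmorph_div !rmorph_nat.
have e32 : 3 / 2 = 6 / 4 :> algC.
  by apply/eqP; rewrite eqr_div ?pnatr_eq0 // -!natrM.
have add4 n : 4^-1 + n%:R / 4 = n.+1%:R / 4 :> algC.
  by rewrite -{1}[4^-1]mul1r -mulrDl nat1r.
have y_s : y \in s.
  apply: sub_s; split.
    apply: DK_of_conj_le => // v vg; rewrite -[v y](subrK (3 / 2)).
    rewrite (le_trans (ler_normD _ _)) // -add4 lerD ?(ltW (near_y _ vg)) //.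
    by rewrite e32 ger0_norm // divr_ge0 ?ler0n.
  move=> wy; have := ltrD (near_y u ug) (wp_conj_lt1 _ _ wy ug).
  rewrite -[ltLHS]addrC => /(le_lt_trans (ler_normB _ _)).
  rewrite opprB addrCA subrr addr0 e32 ger0_norm ?divr_ge0 ?ler0n //.
  have one4 : 1 = 4 / 4 :> algC by rewrite divff ?pnatr_eq0.
  by rewrite [X in _ < _ + X]one4 add4 ltr_pM2r // ltr_nat.
have : y <= M.
  rewrite /M (big_rem y) //= (le_trans (real_ler_norm _)) ?K_real //.
  by rewrite lerDl sumr_ge0.
by move/(lt_le_trans My); rewrite ltxx.
Qed.

(** With a single gap [t], the whole progression [a + n * t] stays in [wp K]; its conjugates under
    [u] have modulus below 1, yet they drift by [n * u t]. *)
Lemma FK_two_elements u :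
  u g != g -> exists d1 d2, [/\ FK K d1, FK K d2 & d1 != d2].
Proof.
move=> ug; apply: NNPP => no_two.
have FK_eq x y : FK K x -> FK K y -> x = y.
  move=> Fx Fy; apply/eqP/negPn/negP => xy.
  by apply: no_two; exists x, y.
have [a wa _] := wp_unbounded _ (real1 _) (lexx 1).
have [b wb Fba] := FK_successor _ wa; pose t := b - a.
have wp_t n : wp K (a + n%:R * t).
  elim: n => [|n IHn]; first by rewrite mul0r addr0.
  have [c wc Fc] := FK_successor _ IHn.
  have := FK_eq _ _ Fc Fba => /eqP; rewrite subr_eq => /eqP Dc.
  by rewrite -natr1 mulrDl mul1r addrA [_ + t]addrC -Dc.
have t0 : u t != 0.
  rewrite fmorph_eq0 /t; have [a1 [a2 [_ _ lt12 -> _]]] := Fba.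
  by rewrite gt_eqF // subr_gt0.
have ut0 : 0 < `|u t| by rewrite normr_gt0.
pose n := Num.bound (2 / `|u t|).
have : 2 < n%:R * `|u t|.
  by rewrite -ltr_pdivrMr // archi_boundP // divr_ge0 ?ler0n.
have -> : n%:R * `|u t| = `|u (a + n%:R * t) - u a|.
  rewrite [u (a + _)]rmorphD [u (_ * _)]rmorphM rmorph_nat.
  by rewrite addrAC subrr add0r normrM normr_nat.
move=> /lt_le_trans /(_ (ler_normB _ _)) lt2.
have := lt_trans lt2 (ltrD (wp_conj_lt1 _ _ (wp_t n) ug) (wp_conj_lt1 _ _ wa ug)).
by rewrite ltxx.
Qed.

End PrimitiveElement.

Theorem theorem1p1 (K : algC -> Prop) (hK : real_number_field K) :
  [/\ DK K 1,
      (forall x, wp K x -> DK K x) /\ (exists x, DK K x /\ ~ wp K x) &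
      (~ (forall x, K x <-> x \in Crat) ->
         infinite_set (fun x => DK K x /\ ~ wp K x) /\
         exists d1 d2, [/\ FK K d1, FK K d2 & d1 != d2])].
Proof.
have [g [Kg Ag genK]] := primitive_element K hK.
have [sK K_real _] := hK.
have D1 : DK K 1 by apply: DK1 Kg Ag genK.
split=> //.
  split; first by move=> x; apply: wp_sub_DK Kg Ag genK _.
  (* Pisot numbers exceed 1 strictly, so 1 itself witnesses that the inclusion is proper, even for
     [K] equal to Q. *)
  by exists 1; split=> // -[_ [_ + _ _] _]; rewrite ltxx.
move=> /(exists_nontrivial_aut _ _ sK genK)[u ug]; split.
  exact: DK_minus_wp_infinite Kg Ag genK u ug.
exact: FK_two_elements Kg Ag genK u ug.
Qed.
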